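(* Fix $c\in\mathbb{N}_0$ and, for $n\in\mathbb{N}$, let $A_n=\mathbb{K}[x_i^2,x_ix_{i+1},\dots,x_ix_{i+c}: i\in[n]]\subseteq R_n=\mathbb{K}[x_1,\dots,x_{n+c}]$, graded by $[A_n]_d=A_n\cap[R_n]_{2d}$. Then the equivariant Hilbert series $\operatorname{equivH}_{\mathcal{A}}(s,t)=\sum_{n\ge1}\sum_{d\ge0}\dim_{\mathbb{K}}[A_n]_d\,t^ds^n$ of the family $\mathcal{A}=(A_n)_{n\in\mathbb{N}}$ is a rational function.
   Context: $\mathbb{K}$ is a field; $R_n$ is standard graded; $[n]=\{1,\dots,n\}$. *)

(* Defs.v *)
From HB Require Import structures.
From mathcomp Require Import all_boot all_order all_algebra.
From mathcomp Require Export mpoly.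
Set Implicit Arguments. Unset Strict Implicit. Unset Printing Implicit Defensive.
Import Order.TTheory GRing.Theory Num.Theory.
Local Open Scope ring_scope.

(* Variables x_1,...,x_{n+c} are 'X_0,...,'X_(n+c-1); so x_k is 'X_(k-1). *)

Lemma gen_idx_lt (n c : nat) (i : 'I_n) (j : 'I_c.+1) : (i + j < n + c)%N.
Proof. have := ltn_ord i; have := ltn_ord j; rewrite ltnS => hj hi.
exact: leq_trans (leq_add hi hj). Qed.

Definition gen (K : fieldType) (n c : nat) (i : 'I_n) (j : 'I_c.+1)
  : {mpoly K[n + c]} :=
  'X_(lshift c i) * 'X_(Ordinal (gen_idx_lt i j)).

Definition gens (K : fieldType) (n c : nat)
  : #|{: 'I_n * 'I_c.+1}|.-tuple {mpoly K[n + c]} :=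
  [tuple gen K (enum_val k).1 (enum_val k).2 | k < #|{: 'I_n * 'I_c.+1}|].

Definition inA (K : fieldType) (n c : nat) (p : {mpoly K[n + c]}) : Prop :=
  exists q : {mpoly K[#|{: 'I_n * 'I_c.+1}|]}, p = q \mPo gens K n c.

Definition inAd (K : fieldType) (n c d : nat) (p : {mpoly K[n + c]}) : Prop :=
  inA p /\ p \is (2 * d)%N.-homog.

Definition has_dim (K : fieldType) (V : lmodType K) (S : V -> Prop) (m : nat)
  : Prop :=
  exists b : 'I_m -> V,
    (forall i, S (b i)) /\
    (forall a : 'I_m -> K, \sum_(i < m) a i *: b i = 0 -> forall i, a i = 0) /\
    (forall v, S v <-> exists a : 'I_m -> K, v = \sum_(i < m) a i *: b i).

(* A bivariate formal power series sum_{n,d} f n d s^n t^d with rational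
   coefficients is a rational function: Q * F = P for polynomials P, Q in
   Q[s,t] with Q <> 0 (coefficients supported in [0,N]^2). *)
Definition rational_series2 (f : nat -> nat -> rat) : Prop :=
  exists (P Q : nat -> nat -> rat) (N : nat),
    (forall i j, (N < i)%N \/ (N < j)%N -> P i j = 0 /\ Q i j = 0) /\
    (exists i j, Q i j != 0) /\
    (forall n d, \sum_(i < n.+1) \sum_(j < d.+1) Q i j * f (n - i)%N (d - j)%N
                 = P n d).

(* Main.v *)
Require Import Defs.
From HB Require Import structures.
From mathcomp Require Import all_boot all_order all_algebra.
From mathcomp Require Import zify ring.
From mathcomp Require Import mpoly.
Import GRing.Theory.

Set Implicit Arguments. Unset Strict Implicit. Unset Printing Implicit Defensive.

(* Number the variables from 0. A monomial lies in [A_n]_d iff its variables can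
   be grouped into d pairs (a, b) with a <= b <= a + c and a < n. Exchanging
   entries between pairs brings such a grouping to a unique standard form: pairs
   with both entries below n, sorted and each paired consecutively, followed by
   "big" pairs (b >= n) in which both the a's and the b's are nondecreasing.

   Conditioning on the first pair of a standard form shows that
   (1 - s - t (1 + s + ... + s^c)) times the Hilbert series is
   s (1 + sum_(k < c) s^k E_k(t)), where E_k counts chains of big pairs with first
   entry n - k - 1. These counts satisfy triangular recurrences in which each
   state has at most one loop, of weight t, so a power of 1 - t turns every E_k
   into a polynomial. *)

(** * Standard forms of sequences of pairs *)

(** [lo] and [hi] are lower bounds for the next first and second entry; once [n <= hi], every pair
    is big. *)
Fixpoint big_pairs (n c lo hi : nat) (s : seq (nat * nat)) : bool :=
  if s is (a, b) :: s' then
    [&& lo <= a, a < n, hi <= b, b <= a + c & big_pairs n c a b s']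
  else true.

(** After a small pair the bound becomes its second entry, so small pairs are consecutive in sorted
    order; from the first big pair on, only big pairs may follow. *)
Fixpoint standard (n c lo : nat) (s : seq (nat * nat)) : bool :=
  if s is (a, b) :: s' then
    if b < n then [&& lo <= a, a <= b, b <= a + c & standard n c b s']
    else big_pairs n c lo n s
  else true.

Lemma standard_cons n c lo a b s : standard n c lo ((a, b) :: s) =
  if b < n then [&& lo <= a, a <= b, b <= a + c & standard n c b s]
  else big_pairs n c lo n ((a, b) :: s).
Proof. by []. Qed.

Fixpoint unpair (s : seq (nat * nat)) : seq nat :=
  if s is (a, b) :: s' then a :: b :: unpair s' else [::].

Lemma size_unpair s : size (unpair s) = (size s).*2.
Proof. by elim: s => //= -[a b] s /= ->. Qed.

Lemma big_pairs_le n c lo lo' hi hi' s : lo' <= lo -> hi' <= hi ->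
  big_pairs n c lo hi s -> big_pairs n c lo' hi' s.
Proof. by case: s => //= -[a b] s ? ? /and5P[? -> ? -> ->]; rewrite !andbT; lia. Qed.

Lemma big_pairs_standard n c lo s : big_pairs n c lo n s -> standard n c lo s.
Proof.
by case: s => //= -[a b] s; case: ifP => // bn /and5P[_ _ nb _ _]; lia.
Qed.

Lemma standard_le n c lo lo' s :
  lo' <= lo -> standard n c lo s -> standard n c lo' s.
Proof.
case: s => //= -[a b] s le_lo; case: ifP => _ /=.
  by move=> /and4P[? -> -> ->]; rewrite !andbT; lia.
exact: (@big_pairs_le n c lo lo' n n ((a, b) :: s)).
Qed.

Lemma big_pairs_lt n c lo hi s :
  big_pairs n c lo hi s -> {in unpair s, forall x, x < n + c}.
Proof.
elim: s lo hi => //= -[a b] s IHs lo hi /and5P[_ ? ? ? /IHs std_s] x.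
by rewrite !inE => /or3P[/eqP-> | /eqP-> | /std_s //] /=; lia.
Qed.

Lemma standard_lt n c lo s :
  standard n c lo s -> {in unpair s, forall x, x < n + c}.
Proof.
elim: s lo => // -[a b] s IHs lo.
rewrite standard_cons; case: ltnP => [bn|_]; last exact: big_pairs_lt.
move=> /and4P[_ ? ? /IHs std_s] x /=.
by rewrite !inE => /or3P[/eqP-> | /eqP-> | /std_s //] /=; lia.
Qed.

(** * Uniqueness of the standard form *)

(** The first entry of a big pair is below [n] and the second is not, so the two filters read off
    the two columns of the chain. *)
Lemma big_pairs_lows_highs n c lo hi s : n <= hi -> big_pairs n c lo hi s ->
  [/\ path leq lo [seq x <- unpair s | x < n],
      path leq hi [seq x <- unpair s | ~~ (x < n)] &
      size [seq x <- unpair s | x < n] = size [seq x <- unpair s | ~~ (x < n)]].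
Proof.
elim: s lo hi => //= -[a b] s IHs lo hi n_hi /and5P[lo_a an hi_b ba /IHs[|p q e]].
  by lia.
by rewrite /= an ltnNge (leq_trans n_hi hi_b) /= lo_a hi_b p q e.
Qed.

(** A small pair adds two low entries, a big pair one low and one high. *)
Lemma standard_lows_highs n c lo s : standard n c lo s ->
  [/\ path leq lo [seq x <- unpair s | x < n],
      sorted leq [seq x <- unpair s | ~~ (x < n)] &
      size [seq x <- unpair s | ~~ (x < n)] <= size [seq x <- unpair s | x < n]].
Proof.
elim: s lo => // -[a b] s IHs lo; rewrite standard_cons; case: ltnP => bn.
  move=> /and4P[lo_a ab bc /IHs[p q e]] /=.
  by rewrite bn (leq_ltn_trans ab bn) /= lo_a ab p q; split=> //; lia.
by move=> /big_pairs_lows_highs[//|-> /path_sorted-> ->].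
Qed.

Lemma big_pairs_lows_highs_inj n c lo lo' hi hi' s s' :
  n <= hi -> n <= hi' -> big_pairs n c lo hi s -> big_pairs n c lo' hi' s' ->
  [seq x <- unpair s | x < n] = [seq x <- unpair s' | x < n] ->
  [seq x <- unpair s | ~~ (x < n)] = [seq x <- unpair s' | ~~ (x < n)] ->
  s = s'.
Proof.
elim: s s' lo lo' hi hi' => [|[a b] s IHs] [|[a' b'] s'] lo lo' hi hi' n_hi n_hi' //=.
- by move=> _ /and5P[_ -> _ _ _].
- by move=> /and5P[_ -> _ _ _].
move=> /and5P[_ an hb _ bs] /and5P[_ an' hb' _ bs']; rewrite an an'.
have [nb nb'] : n <= b /\ n <= b' by lia.
rewrite !ltnNge nb nb' /= => -[-> eq_l] [-> eq_h].
by congr (_ :: _); apply: IHs bs bs' eq_l eq_h.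
Qed.

Lemma standard_lows_highs_inj n c lo lo' s s' :
  standard n c lo s -> standard n c lo' s' ->
  [seq x <- unpair s | x < n] = [seq x <- unpair s' | x < n] ->
  [seq x <- unpair s | ~~ (x < n)] = [seq x <- unpair s' | ~~ (x < n)] ->
  s = s'.
Proof.
(* A small head makes the low entries strictly outnumber the high ones, while a chain of big pairs
   has equally many; hence the two lists decide whether the head is small. *)
have diff_heads : forall lo1 lo2 a b r t, standard n c lo1 ((a, b) :: r) -> b < n ->
    big_pairs n c lo2 n t ->
    size [seq x <- unpair ((a, b) :: r) | x < n]
      = size [seq x <- unpair t | x < n] ->
    size [seq x <- unpair ((a, b) :: r) | ~~ (x < n)]
      <> size [seq x <- unpair t | ~~ (x < n)].
  move=> lo1 lo2 a b r t /= std_r bn; move: std_r; rewrite bn.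
  move=> /and4P[_ ab _ /standard_lows_highs[_ _]] ? /big_pairs_lows_highs[//|_ _ +].
  by rewrite (leq_ltn_trans ab bn) /=; lia.
elim: s s' lo lo' => [|[a b] s IHs] [|[a' b'] s'] lo lo' //.
- move=> _ std_s' eq_l eq_h; have [b'n|nb'] := ltnP b' n.
    have := diff_heads _ 0 _ _ _ [::] std_s' b'n isT.
    by rewrite -eq_l -eq_h => /(_ erefl).
  move: std_s' eq_l => /=; rewrite (ltnNge b') nb' /=.
  by move=> /and4P[_ -> _ _].
- move=> std_s _ eq_l eq_h; have [bn|nb] := ltnP b n.
    have := diff_heads _ 0 _ _ _ [::] std_s bn isT.
    by rewrite eq_l eq_h => /(_ erefl).
  move: std_s eq_l => /=; rewrite (ltnNge b) nb /=.
  by move=> /and4P[_ -> _ _].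
move=> std_s std_s' eq_l eq_h.
have [bn|nb] := ltnP b n; have [b'n|nb'] := ltnP b' n.
- move: std_s std_s' eq_l eq_h => /=; rewrite bn b'n /=.
  move=> /and4P[_ ab _ std_s] /and4P[_ ab' _ std_s'].
  rewrite (leq_ltn_trans ab bn) (leq_ltn_trans ab' b'n) /= => -[-> -> eq_l] eq_h.
  by congr (_ :: _); apply: IHs std_s std_s' eq_l eq_h.
- move: std_s'; rewrite standard_cons ltnNge nb' => big_s'.
  by case: (diff_heads _ _ _ _ _ ((a', b') :: s') std_s bn big_s'); rewrite ?eq_l ?eq_h.
- move: std_s; rewrite standard_cons ltnNge nb => big_s.
  by case: (diff_heads _ _ _ _ _ ((a, b) :: s) std_s' b'n big_s); rewrite ?eq_l ?eq_h.
- move: std_s; rewrite standard_cons ltnNge nb => big_s.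
  move: std_s'; rewrite standard_cons ltnNge nb' => big_s'.
  exact: (@big_pairs_lows_highs_inj n c _ _ n n ((a, b) :: s) ((a', b') :: s')
            _ _ big_s big_s').
Qed.

(** The low and the high entries both occur in sorted order, so the multiset of entries determines
    both lists. *)
Lemma standard_perm_inj n c lo s s' :
  standard n c lo s -> standard n c lo s' ->
  perm_eq (unpair s) (unpair s') -> s = s'.
Proof.
move=> std_s std_s' eq_s.
have [/path_sorted l h _] := standard_lows_highs std_s.
have [/path_sorted l' h' _] := standard_lows_highs std_s'.
apply: standard_lows_highs_inj std_s std_s' _ _;
  by apply: (sorted_eq leq_trans anti_leq) => //; apply: perm_filter.
Qed.

(** * Existence of the standard form: inserting one pair *)

(** Compare with the head: the entrywise minima form the new head and the entrywise maxima are
    inserted into the tail. Both pairs still satisfy the distance bound. *)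
Lemma big_pairs_insert_big n c lo hi a b s :
  lo <= a < n -> hi <= b <= a + c -> big_pairs n c lo hi s ->
  exists2 s', big_pairs n c lo hi s' & perm_eq (unpair s') (a :: b :: unpair s).
Proof.
elim: s lo hi a b => [|[x y] s IHs] lo hi a b lo_a hi_b.
  by move=> _; exists [:: (a, b)] => //=; lia.
move=> /= /and5P[lo_x xn hi_y yc big_s].
have [|||s' big_s' eq_s'] := IHs (minn a x) (minn b y) (maxn a x) (maxn b y).
- by lia.
- by lia.
- by apply: big_pairs_le big_s; lia.
exists ((minn a x, minn b y) :: s'); first by rewrite /= big_s'; lia.
apply/permP => p; move/permP/(_ p): eq_s' => /= ->.
by rewrite /minn /maxn; case: (ltnP a x); case: (ltnP b y); lia.
Qed.

Lemma big_pairs_insert_small n c lo hi a b s : n <= hi ->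
  lo <= a -> a <= b <= a + c -> b < n -> big_pairs n c lo hi s ->
  exists p q s', [/\ lo <= p, p <= q <= p + c, q < n, big_pairs n c q hi s' &
                     perm_eq (p :: q :: unpair s') (a :: b :: unpair s)].
Proof.
elim: s lo hi a b => [|[x y] s IHs] lo hi a b n_hi lo_a ab bn.
  by move=> _; exists a, b, [::]; split.
move=> /= /and5P[lo_x xn hi_y yc big_s].
have [bx|xb] := leqP b x.
  by exists a, b, ((x, y) :: s); split=> //=; rewrite bx xn hi_y yc.
have [ax|xa] := leqP a x.
  (* Here [a <= x < b]: exchanging [b] with [x] leaves the small pair [(a, x)] and the big pair
     [(b, y)]. *)
  have [|||s' big_s' eq_s'] := @big_pairs_insert_big n c x hi b y s.
  - by lia.
  - by lia.
  - exact: big_pairs_le big_s.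
  exists a, x, s'; split=> //; try lia.
  by apply/permP => p; move/permP/(_ p): eq_s' => /= ->; lia.
(* Here [x < a]. The small pair obtained from the tail is split: [p] joins [x], which is allowed
   because [p < n <= y <= x + c], and [q] joins [y]. *)
have [|||||p [q [s' [xp pq qn big_s' eq_s']]]] := IHs x y a b; try lia.
exists x, p, ((q, y) :: s'); split=> //=; try lia.
by apply/permP => r; move/permP/(_ r): eq_s' => /=; lia.
Qed.

(** Against a small head [(x, y)], the two smallest of [a], [x], [y] form the new head and the
    largest keeps [b] as partner. If [a < x], then [x < n <= b <= a + c] bounds the distance in the
    new head. *)
Lemma standard_insert_big n c lo a b s :
  lo <= a < n -> n <= b <= a + c -> standard n c lo s ->
  exists2 s', standard n c lo s' & perm_eq (unpair s') (a :: b :: unpair s).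
Proof.
have insert_big t lo1 a1 : lo1 <= a1 < n -> n <= b <= a1 + c ->
    big_pairs n c lo1 n t ->
    exists2 s', standard n c lo1 s' & perm_eq (unpair s') (a1 :: b :: unpair t).
  move=> lo_a nb big_t.
  have [s' /big_pairs_standard] := big_pairs_insert_big lo_a nb big_t.
  by exists s'.
elim: s lo a => [|[x y] s IHs] lo a lo_a nb; first by move=> _; apply: insert_big.
rewrite standard_cons; case: ltnP => yn; last exact: insert_big.
move=> /and4P[lo_x xy yc std_s].
have [|||s' std_s' eq_s'] := IHs (minn y (maxn a x)) (maxn a y); try lia.
  by apply: standard_le std_s; lia.
exists ((minn a x, minn y (maxn a x)) :: s').
  by rewrite /= std_s'; case: ifP; lia.
apply/permP => p; move/permP/(_ p): eq_s' => /= ->.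
rewrite /minn /maxn; case: (ltnP a x) => ?; case: (ltnP a y) => ?;
  case: ltnP => ? /=; try lia.
by have -> : a = y; lia.
Qed.

(* The two smallest of the four entries of two small pairs are at distance at
   most [c], and so are the two largest. *)
Lemma standard_insert_small n c lo a b s :
  lo <= a -> a <= b <= a + c -> b < n -> standard n c lo s ->
  exists2 s', standard n c lo s' & perm_eq (unpair s') (a :: b :: unpair s).
Proof.
have insert_big t lo1 a1 b1 : lo1 <= a1 -> a1 <= b1 <= a1 + c -> b1 < n ->
    big_pairs n c lo1 n t ->
    exists2 s', standard n c lo1 s' & perm_eq (unpair s') (a1 :: b1 :: unpair t).
  move=> lo_a ab bn big_t.
  have [p [q [s' [lp pq qn big_s' eq_s']]]] :=
    big_pairs_insert_small (leqnn n) lo_a ab bn big_t.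
  exists ((p, q) :: s') => //=; rewrite qn lp big_pairs_standard //; lia.
elim: s lo a b => [|[x y] s IHs] lo a b lo_a ab bn.
  by move=> _; apply: insert_big.
rewrite standard_cons; case: ltnP => yn; last exact: insert_big.
move=> /and4P[lo_x xy yc std_s].
pose z1 := minn a x; pose z2 := minn (maxn a x) (minn b y).
pose z3 := maxn (maxn a x) (minn b y); pose z4 := maxn b y.
have [||||s' std_s' eq_s'] := IHs z2 z3 z4; try by rewrite /z2 /z3 /z4; lia.
  by apply: standard_le std_s; rewrite /z2; lia.
exists ((z1, z2) :: s').
  by rewrite /= std_s' /z1 /z2; case: ifP; lia.
apply/permP => p; move/permP/(_ p): eq_s' => /= ->.
rewrite /z1 /z2 /z3 /z4 /minn /maxn; case: (ltnP a x); case: (ltnP b y) => ? ?;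
  by case: ltnP => ? /=; lia.
Qed.

Lemma standard_insert n c lo a b s :
  lo <= a < n -> a <= b <= a + c -> standard n c lo s ->
  exists2 s', standard n c lo s' & perm_eq (unpair s') (a :: b :: unpair s).
Proof.
have [bn|nb] := ltnP b n => /andP[lo_a an] ab.
  exact: standard_insert_small.
by apply: standard_insert_big; lia.
Qed.

(** * Enumeration and counting of standard forms *)

Section ConsPairs.
Variables (T : eqType) (heads : seq T) (tails : T -> seq (seq T)).

Definition cons_pairs := [seq p :: s | p <- heads, s <- tails p].

Lemma mem_cons_pairs p s :
  (p :: s \in cons_pairs) = (p \in heads) && (s \in tails p).
Proof.
apply/allpairsPdep/andP => [[q [t [? ? [-> ->]]]] // | [? ?]].
by exists p, s.
Qed.

Lemma nil_notin_cons_pairs : [::] \notin cons_pairs.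
Proof. by apply/negP => /allpairsPdep[q [t []]]. Qed.

Lemma uniq_cons_pairs :
  uniq heads -> (forall p, uniq (tails p)) -> uniq cons_pairs.
Proof.
move=> Uh Ut; apply: allpairs_uniq_dep => // -[p s] [q t] _ _ /= [-> ->] //.
Qed.

Lemma size_cons_pairs : size cons_pairs = \sum_(p <- heads) size (tails p).
Proof. by rewrite size_allpairs_dep sumnE big_map. Qed.

End ConsPairs.

(* Below, bounds are measured from [n] so that the counts do not depend on it:
   [k] stands for the lower bound [n - k] and [e] for the lower bound [n + e]. *)
Definition big_heads (n c k e : nat) : seq (nat * nat) :=
  [seq (n - f.+1, n + (e + i)) | f <- index_iota 0 k, i <- index_iota 0 (c - f - e)].

Fixpoint bigs (n c d k e : nat) : seq (seq (nat * nat)) :=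
  if d is d'.+1 then
    cons_pairs (big_heads n c k e) (fun p => bigs n c d' (n - p.1) (p.2 - n))
  else [:: [::]].

Definition standard_heads (n c k : nat) : seq (nat * nat) :=
  [seq (n - f.+1, n - f.+1 + j) | f <- index_iota 0 k, j <- index_iota 0 c.+1].

Fixpoint standards (n c d k : nat) : seq (seq (nat * nat)) :=
  if d is d'.+1 then
    cons_pairs (standard_heads n c k)
      (fun p => if p.2 < n then standards n c d' (n - p.2)
                else bigs n c d' (n - p.1) (p.2 - n))
  else [:: [::]].

(** The first pair is [(n - f.+1, n + e + i)], whose distance is at most [c] exactly when
    [i < c - f - e]. *)
Fixpoint nbig (c d k e : nat) : nat :=
  if d is d'.+1 then
    \sum_(0 <= f < k) \sum_(0 <= i < c - f - e) nbig c d' f.+1 (e + i)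
  else 1.

(** The first pair is [(n - f.+1, n - f.+1 + j)], which is small exactly when [j <= f]. *)
Fixpoint nstd (c d k : nat) : nat :=
  if d is d'.+1 then
    \sum_(0 <= f < k) \sum_(0 <= j < c.+1)
      if j <= f then nstd c d' (f.+1 - j) else nbig c d' f.+1 (j - f.+1)
  else 1.

Lemma mem_big_heads n c k e a b : k <= n ->
  ((a, b) \in big_heads n c k e) = [&& n - k <= a, a < n, n + e <= b & b <= a + c].
Proof.
move=> kn; apply/allpairsPdep/and4P => [[f [i []]]|[? ? ? ?]].
  by rewrite !mem_index_iota => ? ? [-> ->]; split; lia.
exists (n - a.+1), (b - n - e); rewrite !mem_index_iota; split; try lia.
by congr pair; lia.
Qed.

Lemma mem_standard_heads n c k a b : k <= n ->
  ((a, b) \in standard_heads n c k) = [&& n - k <= a, a < n, a <= b & b <= a + c].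
Proof.
move=> kn; apply/allpairsPdep/and4P => [[f [i []]]|[? ? ? ?]].
  by rewrite !mem_index_iota => ? ? [-> ->]; split; lia.
exists (n - a.+1), (b - a); rewrite !mem_index_iota; split; try lia.
by congr pair; lia.
Qed.

Lemma uniq_big_heads n c k e : k <= n -> uniq (big_heads n c k e).
Proof.
move=> kn; apply: allpairs_uniq_dep => [|f _|]; rewrite ?iota_uniq //.
move=> _ _ /allpairsPdep[f [i [+ _ ->]]] /allpairsPdep[f' [i' [+ _ ->]]] /=.
rewrite !mem_index_iota => ? ? [? ?]; have -> : f = f' by lia.
by have -> : i = i' by lia.
Qed.

Lemma uniq_standard_heads n c k : k <= n -> uniq (standard_heads n c k).
Proof.
move=> kn; apply: allpairs_uniq_dep => [|f _|]; rewrite ?iota_uniq //.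
move=> _ _ /allpairsPdep[f [i [+ _ ->]]] /allpairsPdep[f' [i' [+ _ ->]]] /=.
rewrite !mem_index_iota => ? ? [? ?]; have -> : f = f' by lia.
by have -> : i = i' by lia.
Qed.

Lemma mem_bigs n c d k e s : k <= n ->
  (s \in bigs n c d k e) = big_pairs n c (n - k) (n + e) s && (size s == d).
Proof.
elim: d k e s => [|d IHd] k e s kn.
  by rewrite inE; case: s => //= *; rewrite andbF.
case: s => [|[a b] s]; first by rewrite (negbTE (nil_notin_cons_pairs _ _)).
rewrite mem_cons_pairs mem_big_heads // IHd ?leq_subr //= eqSS.
case: (boolP [&& _, _, _ & _]) => [/and4P[-> an nb ->]|]; last first.
  move=> nh; apply/esym/negP => /andP[/and5P[h1 h2 h3 h4 _] _].
  by move: nh; rewrite h1 h2 h3 h4.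
rewrite an nb subKn 1?ltnW // subnKC //; lia.
Qed.

Lemma mem_standards n c d k s : k <= n ->
  (s \in standards n c d k) = standard n c (n - k) s && (size s == d).
Proof.
elim: d k s => [|d IHd] k s kn.
  by rewrite inE; case: s => //= *; rewrite andbF.
case: s => [|[a b] s]; first by rewrite (negbTE (nil_notin_cons_pairs _ _)).
rewrite mem_cons_pairs mem_standard_heads //= eqSS.
case: (boolP (b < n)) => bn.
  rewrite IHd ?leq_subr // (subKn (ltnW bn)) andbA; congr (_ && _).
  by case: (standard n c b s); lia.
rewrite -leqNgt in bn; rewrite mem_bigs ?leq_subr // subnKC // andbA.
congr (_ && _).
have [an|na] := ltnP a n; last by lia.
by rewrite (subKn (ltnW an)); case: big_pairs; lia.
Qed.

Lemma uniq_bigs n c d k e : k <= n -> uniq (bigs n c d k e).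
Proof.
elim: d k e => // d IHd k e kn; apply: uniq_cons_pairs => [|p].
  exact: uniq_big_heads.
exact/IHd/leq_subr.
Qed.

Lemma uniq_standards n c d k : k <= n -> uniq (standards n c d k).
Proof.
elim: d k => // d IHd k kn; apply: uniq_cons_pairs => [|p].
  exact: uniq_standard_heads.
by case: ifP => _; [apply/IHd/leq_subr | apply/uniq_bigs/leq_subr].
Qed.

Lemma size_bigs n c d k e : k <= n -> size (bigs n c d k e) = nbig c d k e.
Proof.
elim: d k e => // d IHd k e kn; rewrite /= size_cons_pairs big_allpairs_dep /=.
apply: eq_big_nat => f /andP[_ fk].
apply: eq_big_nat => i _.
by rewrite IHd ?leq_subr // subKn ?(leq_trans fk) // addKn.
Qed.

Lemma size_standards n c d k : k <= n -> size (standards n c d k) = nstd c d k.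
Proof.
elim: d k => // d IHd k kn; rewrite /= size_cons_pairs big_allpairs_dep /=.
apply: eq_big_nat => f /andP[_ fk].
apply: eq_big_nat => j _.
have -> : (n - f.+1 + j < n) = (j <= f) by lia.
case: leqP => jf; rewrite ?IHd ?size_bigs ?leq_subr //.
  by congr nstd; lia.
by congr nbig; lia.
Qed.

(** * Power series in [t] that a power of [1 - t] turns into polynomials *)

Local Open Scope ring_scope.

Definition shift (v : nat -> rat) (r : nat) : rat := if r is r'.+1 then v r' else 0.

(* The coefficients of [(1 - t) * v(t)]. *)
Definition dif (v : nat -> rat) (r : nat) : rat := v r - shift v r.

Lemma eq_iter_dif K u v : u =1 v -> iter K dif u =1 iter K dif v.
Proof. by move=> eq_uv; elim: K => //= K IHK [|r]; rewrite /dif /= !IHK. Qed.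

Lemma iter_dif_sum K (I : Type) (s : seq I) (F : I -> nat -> rat) r :
  iter K dif (fun r => \sum_(i <- s) F i r) r = \sum_(i <- s) iter K dif (F i) r.
Proof.
elim: K r => //= K IHK [|r]; rewrite /dif /= !IHK ?subr0.
  by under [RHS]eq_bigr do rewrite subr0.
by rewrite -sumrB.
Qed.

Lemma iter_dif_add K u v r :
  iter K dif (fun r => u r + v r) r = iter K dif u r + iter K dif v r.
Proof. by elim: K r => //= K IHK [|r]; rewrite /dif /= !IHK; ring. Qed.

Lemma iter_dif_shift K v r : iter K dif (shift v) r = shift (iter K dif v) r.
Proof.
by elim: K r => //= K IHK [|[|r]]; rewrite /dif /= !IHK ?subrr.
Qed.

(** Multiplying one factor of a product by a power of [1 - t] multiplies the product. *)
Lemma iter_dif_conv K q v d :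
  \sum_(j < d.+1) iter K dif q j * v (d - j)%N =
  iter K dif (fun d => \sum_(j < d.+1) q j * v (d - j)%N) d.
Proof.
elim: K d => //= K IHK d; rewrite /dif -IHK.
under eq_bigr do rewrite mulrBl.
rewrite sumrB; congr (_ - _); rewrite big_ord_recl /= mul0r add0r.
by case: d => [|d]; rewrite ?big_ord0 //= -IHK.
Qed.

Lemma iter_dif_vanish K N v r :
  (forall r, (N < r)%N -> v r = 0) -> (N + K < r)%N -> iter K dif v r = 0.
Proof.
move=> v0; elim: K r => [|K IHK] r /= lt_r; first by apply: v0; lia.
by rewrite /dif; case: r lt_r => [|r] lt_r //=; rewrite !IHK ?subr0 //; lia.
Qed.

(** The generating function of [v] is a polynomial divided by a power of [1 - t]. *)
Definition quasi (v : nat -> rat) : Prop :=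
  exists K N, forall r, (N < r)%N -> iter K dif v r = 0.

(** Raising the exponent lets several series share one power of [1 - t]; the degree grows by at most
    the exponent. *)
Lemma quasi_uniform v K0 N0 : (forall r, (N0 < r)%N -> iter K0 dif v r = 0) ->
  forall K r, (K0 <= K)%N -> (N0 + K < r)%N -> iter K dif v r = 0.
Proof.
move=> v0 K r leK lt_r; rewrite -(subnK leK) iterD.
by apply: iter_dif_vanish v0 _; lia.
Qed.

Lemma quasi_eq u v : u =1 v -> quasi u -> quasi v.
Proof.
by move=> eq_uv [K [N u0]]; exists K, N => r /u0; rewrite (eq_iter_dif _ eq_uv).
Qed.

Lemma quasi_add u v : quasi u -> quasi v -> quasi (fun r => u r + v r).
Proof.
move=> [K [N u0]] [L [M v0]]; exists (K + L)%N, (N + M + (K + L))%N => r lt_r.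
rewrite iter_dif_add (quasi_uniform u0) ?(quasi_uniform v0) ?addr0 //; lia.
Qed.

Lemma quasi_finsupp N v : (forall r, (N < r)%N -> v r = 0) -> quasi v.
Proof. by exists 0%N, N. Qed.

Lemma quasi_sum (I : Type) (s : seq I) (F : I -> nat -> rat) :
  (forall i, quasi (F i)) -> quasi (fun r => \sum_(i <- s) F i r).
Proof.
move=> qF; elim: s => [|i s IHs].
  by apply: (@quasi_finsupp 0) => r _; rewrite big_nil.
by apply: quasi_eq (quasi_add (qF i) IHs) => r; rewrite big_cons.
Qed.

Lemma quasi_shift v : quasi v -> quasi (shift v).
Proof.
move=> [K [N v0]]; exists K, N.+1 => -[|r] // lt_r.
by rewrite iter_dif_shift /= v0.
Qed.

Lemma quasi_dif v : quasi (dif v) -> quasi v.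
Proof. by move=> [K [N v0]]; exists K.+1, N => r; rewrite iterSr; apply: v0. Qed.

(** * Generating functions of chains of big pairs *)

Lemma nbigS c d k e : nbig c d.+1 k.+1 e =
  (nbig c d.+1 k e + \sum_(0 <= i < c - k - e) nbig c d k.+1 (e + i))%N.
Proof. by rewrite [LHS]big_nat_recr. Qed.

(** Induction on [k], then on the number [c - k - e] of second entries available to the first entry
    [n - k.+1]. *)
Lemma quasi_nbig c k e : quasi (fun d => (nbig c d k e)%:R).
Proof.
elim: k e => [|k IHk] e.
  apply: (@quasi_finsupp 0) => -[//|d] _.
  by rewrite /= big_nil.
have [m] := ubnP (c - k - e)%N; elim: m e => // m IHm e lt_m.
have [ce0|ce_gt0] := posnP (c - k - e).
  apply: quasi_eq (IHk e) => -[//|d]; rewrite nbigS.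
  by rewrite ce0 [X in (_ + X)%N]big_nil addn0.
(* In [nbigS] the term [i = 0] is the loop at the state [(k.+1, e)]; moving it to the left gives the
   factor [1 - t]. The other terms have a larger [e] and fall under [IHm]. *)
apply: quasi_dif.
pose w i d : rat := (nbig c d k.+1 (e + i.+1))%:R.
pose W d : rat := \sum_(i <- iota 0 (c - k - e).-1) w i d.
have qW : quasi W.
  rewrite /W.
  have qw : forall i, quasi (w i).
    by move=> i; apply: IHm; lia.
  exact: quasi_sum.
apply: quasi_eq (quasi_add (IHk e) (quasi_shift qW)) => -[|d].
  by rewrite /dif /= ?subr0 ?addr0.
rewrite /dif nbigS natrD [shift _ _]/= [shift _ _]/=.
rewrite -[(c - k - e)%N in RHS](prednK ce_gt0) big_nat_recl // addn0 natrD.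
have -> : W d = (\sum_(0 <= i < (c - k - e).-1) nbig c d k.+1 (e + i.+1))%N%:R.
  by rewrite natr_sum /W /index_iota subn0.
ring.
Qed.

(* For [k < n], [edge c k d] counts the standard sequences of [d] pairs which
   start with the fixed low entry [n - k.+1] and whose pairs are all big. *)
Definition edge (c k d : nat) : nat :=
  if d is d'.+1 then
    \sum_(0 <= j < c.+1) (if (k < j)%N then nbig c d' k.+1 (j - k.+1) else 0%N)
  else 0%N.

Lemma quasi_edge c k : quasi (fun d => (edge c k d)%:R).
Proof.
pose w j d : rat := if (k < j)%N then (nbig c d k.+1 (j - k.+1))%:R else 0.
have qw j : quasi (w j).
  rewrite /w; case: (k < j)%N ; first exact: quasi_nbig.
  by apply: (@quasi_finsupp 0).
apply: quasi_eq (quasi_shift (quasi_sum (index_iota 0 c.+1) qw)) => -[//|d] /=.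
by rewrite natr_sum; apply: eq_bigr => j _; rewrite /w; case: ifP.
Qed.

(** From the entry [n - k.+1], a step of at most [c <= k] cannot reach [n]. *)
Lemma edge_eq0 c k d : (c <= k)%N -> edge c k d = 0%N.
Proof.
case: d => //= d ck; rewrite big_nat big1 // => j jc.
by case: ifP => //; lia.
Qed.

(** * The functional equation and rationality *)

(** The sum starts at [n = 1], so column [0] is cleared although [nstd c 0 0 = 1]. *)
Definition series c n d : rat := if n is 0 then 0 else (nstd c d n)%:R.

Lemma seriesS c n d : series c n.+1 d.+1 =
  series c n d.+1 + \sum_(i < n.+2) (i <= c)%N%:R * series c (n.+1 - i) d
  + (edge c n d.+1)%:R.
Proof.
have -> : series c n d.+1 = (nstd c d.+1 n)%:R.
  by case: n => //=; rewrite big_nil.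
have -> : \sum_(i < n.+2) (i <= c)%N%:R * series c (n.+1 - i) d =
    (\sum_(0 <= j < c.+1) if (j <= n)%N then nstd c d (n.+1 - j) else 0)%N%:R.
  (* The term [i = n.+1] vanishes because column [0] of [series] is zero. *)
  rewrite big_ord_recr /= subnn mulr0 addr0.
  rewrite -(big_mkord xpredT (fun i => (i <= c)%N%:R * series c (n.+1 - i) d)).
  rewrite -big_mkcond natr_sum /=.
  under eq_big_nat => i /andP[_ iN].
    rewrite (_ : _ * _ = if (i <= c)%N then (nstd c d (n.+1 - i))%:R else 0);
      last first.
      by rewrite subSn //=; case: ifP => _; rewrite ?mul1r ?mul0r.
    over.
  rewrite -big_mkcond /= (big_nat_widen _ _ (maxn c n).+1) ?ltnS ?leq_maxr //.
  rewrite [RHS](big_nat_widen _ _ (maxn c n).+1) ?ltnS ?leq_maxl //.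
  by apply: eq_bigl => i; rewrite /= !ltnS andbC.
rewrite -!natrD /=; congr _%:R; rewrite big_nat_recr //= -addnA; congr addn.
rewrite -big_split /=; apply: eq_bigr => j _.
by rewrite [(n < j)%N]ltnNge; case: leqP => _ /=; rewrite ?addn0 ?add0n.
Qed.

(* The coefficients of [1 - s - t (1 + s + ... + s^c)]. *)
Definition denom (c i j : nat) : rat :=
  match j with
  | 0 => (i == 0%N)%:R - (i == 1%N)%:R
  | 1 => - (i <= c)%N%:R
  | _ => 0
  end.

(** The coefficients of [s (1 + sum_k s^k E_k(t))], with [edge c k] in the role of [E_k]. *)
Definition numer (c n d : nat) : rat :=
  if n is n'.+1 then ((n' == 0%N) && (d == 0%N))%:R + (edge c n' d)%:R else 0.

Lemma denom_conv c n d :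
  \sum_(i < n.+1) \sum_(j < d.+1) denom c i j * series c (n - i) (d - j) =
  numer c n d.
Proof.
have first_col F : \sum_(i < n.+1) denom c i 0 * F (n - i)%N =
    F n - shift F n :> rat.
  rewrite big_ord_recl /= subn0 subr0 mul1r; congr (_ + _).
  case: n => [|n]; first by rewrite big_ord0 /= oppr0.
  rewrite big_ord_recl /= big1 => [|i _]; last by rewrite /bump /= subrr mul0r.
  by rewrite subn1 sub0r mulN1r addr0.
case: d => [|d].
  under eq_bigr do rewrite big_ord_recl big_ord0 addr0 subn0.
  rewrite (first_col (fun m => series c m 0)).
  by case: n {first_col} => [|[|n]]; rewrite /= ?subrr ?subr0 ?addr0.
under eq_bigr => i _.
  rewrite 2!big_ord_recl /= big1 => [|j _]; last by rewrite mul0r.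
  rewrite addr0 subn0 subSS subn0; over.
rewrite big_split /= (first_col (fun m => series c m d.+1)).
case: n {first_col} => [|n]; first by rewrite big_ord1 /= mulr0 ?subrr ?addr0.
under [X in _ + X]eq_bigr do rewrite mulNr.
by rewrite sumrN seriesS /numer andbF /= add0r; ring.
Qed.

Lemma rational_series c : rational_series2 (series c).
Proof.
(* Only the columns [n <= c.+1] can be nonzero, so one exponent [K] serves for all of them, and then
   one degree bound [N]. *)
have [K Kn] : exists K, forall n, (n <= c.+1)%N ->
    exists N, forall r, (N < r)%N -> iter K dif (numer c n) r = 0.
  have qn n : quasi (numer c n).
    case: n => [|n]; first by apply: (@quasi_finsupp 0).
    apply: quasi_add (quasi_edge c n).
    by apply: (@quasi_finsupp 0) => -[|r] // _; rewrite andbF.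
  elim: c.+1 => [|m [K IHm]].
    by have [K [N KN]] := qn 0%N; exists K => n; rewrite leqn0 => /eqP->; exists N.
  have [L [M LM]] := qn m.+1; exists (K + L)%N => n; rewrite leq_eqVlt.
  case/predU1P => [->|/IHm[N KN]].
    exists (M + (K + L))%N => r; apply: (quasi_uniform LM); exact: leq_addl.
  exists (N + (K + L))%N => r; apply: (quasi_uniform KN); exact: leq_addr.
have [N Nn] : exists N, forall n r, (n <= c.+1)%N -> (N < r)%N ->
    iter K dif (numer c n) r = 0.
  elim: c.+1 Kn => [|m IHm] Kn.
    by have [N NP] := Kn 0%N isT; exists N => n r; rewrite leqn0 => /eqP->; apply: NP.
  have [|N NP] := IHm _; first by move=> n nm; apply: Kn; apply: leqW.
  have [M MP] := Kn m.+1 (leqnn _); exists (N + M)%N => n r; rewrite leq_eqVlt.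
  by case/predU1P => [->|nm] lt_r; [apply: MP | apply: NP => //]; lia.
(* Numerator and denominator are both multiplied by the [K]-th power of [1 - t]. Their degrees in
   [s] are at most [c.+1], those in [t] at most [N] and [K.+1]. *)
exists (fun n => iter K dif (numer c n)), (fun i => iter K dif (denom c i)).
exists (N + c.+1 + K.+1)%N; split; last split.
- move=> i j; case: (leqP i c.+1) => [ic|ci].
    case=> [|lt_j]; first by lia.
    split; first by apply: Nn; lia.
    by apply: (@iter_dif_vanish K 1) => [[|[|r]]|] //; lia.
  have z0 v : v =1 (fun=> 0) -> iter K dif v j = 0.
    move=> v0; rewrite (eq_iter_dif _ v0).
    elim: K {Kn Nn} j => //= K IHK j; rewrite /dif !IHK.
    by case: j => [|j] /=; rewrite ?IHK subrr.
  move=> _; split; apply: z0 => r.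
    case: i ci => [//|[//|i]] ci.
    by rewrite /numer edge_eq0 ?addr0 //; lia.
  case: r => [|[|r]] //; case: i ci => [//|[//|i]] ci; rewrite /denom ?subrr //.
  by rewrite leqNgt ltnW ?oppr0.
(* The constant coefficient of [denom] is 1, and multiplying by [1 - t] preserves it. *)
- exists 0%N, 0%N; rewrite (_ : iter _ _ _ _ = 1) ?oner_eq0 //.
  by elim: K {Kn Nn} => //= K IHK; rewrite /dif /= IHK subr0.
- move=> n d.
  under eq_bigr do rewrite iter_dif_conv.
  rewrite -(iter_dif_sum K _ (fun (i : 'I_n.+1) d => \sum_(j < d.+1) denom c i j *
     series c (n - i) (d - j))).
  by apply: eq_iter_dif => r; rewrite denom_conv.
Qed.

(** * The monomial basis of each graded component *)

Lemma has_dim_monomials (K : fieldType) (n : nat) (S : {mpoly K[n]} -> Prop)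
    (L : seq 'X_{1..n}) :
  uniq L -> (forall p, S p <-> {subset msupp p <= L}) -> has_dim S (size L).
Proof.
move=> UL SP; pose b (i : 'I_(size L)) : {mpoly K[n]} := 'X_[nth 0%MM L i].
(* Reading off coefficients gives independence, and supplies the coordinates for spanning. *)
have coef (a : 'I_(size L) -> K) (i : 'I_(size L)) :
    (\sum_i a i *: b i)@_(nth 0%MM L i) = a i.
  rewrite raddf_sum (bigD1 i) //= mcoeffZ mcoeffX eqxx mulr1.
  rewrite big1 ?addr0 // => j ji.
  by rewrite mcoeffZ mcoeffX nth_uniq // val_eqE (negbTE ji) mulr0.
exists b; split; [|split].
- move=> i; apply/SP => m; rewrite msuppX inE => /eqP->.
  exact: mem_nth.
- by move=> a a0 i; rewrite -(coef a) a0 mcoeff0.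
move=> v; rewrite SP; split=> [vL|[a ->] m].
  exists (fun i => v@_(nth 0%MM L i)); apply/mpolyP => m.
  have [/(nthP 0%MM)[k kL <-]|mL] := boolP (m \in L).
    by rewrite (coef _ (Ordinal kL)).
  rewrite (memN_msupp_eq0 (contra (vL m) mL)) raddf_sum big1 //= => i _.
  rewrite mcoeffZ mcoeffX; case: eqP => [e|_]; last by rewrite mulr0.
  by rewrite -e mem_nth in mL.
apply: contraLR => mL; rewrite mcoeff_msupp negbK raddf_sum big1 //= => i _.
rewrite mcoeffZ mcoeffX; case: eqP => [e|_]; last by rewrite mulr0.
by rewrite -e mem_nth in mL.
Qed.

Section Monomials.
Variables (n c : nat).

Definition mon (s : seq (nat * nat)) : 'X_{1..n + c} :=
  [multinom count_mem (i : nat) (unpair s) | i < n + c].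

Lemma mon_nil : mon [::] = 0%MM.
Proof. by apply/mnmP => i; rewrite [LHS]mnmE [RHS]mnmE. Qed.

Lemma mon_cons (i : 'I_n) (j : 'I_c.+1) s :
  mon ((val i, i + j)%N :: s) =
  (U_(lshift c i) + U_(Ordinal (gen_idx_lt i j)) + mon s)%MM.
Proof.
by apply/mnmP => k; rewrite !mnmDE !mnm1E !mnmE /= -addnA -!val_eqE.
Qed.

Lemma eq_mon s s' : perm_eq (unpair s) (unpair s') -> mon s = mon s'.
Proof. by move/permP => eq_s; apply/mnmP => i; rewrite !mnmE. Qed.

(** All entries of a standard form are below [n + c], so the exponent vector records the whole
    multiset of entries. *)
Lemma mon_inj lo lo' s s' :
  standard n c lo s -> standard n c lo' s' -> mon s = mon s' -> s = s'.
Proof.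
move=> std_s std_s' /mnmP eq_m.
apply: standard_perm_inj (standard_le (leq0n _) std_s)
  (standard_le (leq0n _) std_s') _.
apply/allP => x; rewrite mem_cat => xs /=; apply/eqP.
have x_lt : (x < n + c)%N.
  by case/orP: xs; [apply: (standard_lt std_s) | apply: (standard_lt std_s')].
by have := eq_m (Ordinal x_lt); rewrite !mnmE.
Qed.

Definition monomials d : seq 'X_{1..n + c} := map mon (standards n c d n).

Lemma uniq_monomials d : uniq (monomials d).
Proof.
rewrite map_inj_in_uniq ?uniq_standards // => s s'; rewrite !mem_standards //.
by move=> /andP[std_s _] /andP[std_s' _]; apply: mon_inj std_s std_s'.
Qed.

Lemma mem_monomials d m :
  reflect (exists s, [/\ standard n c 0 s, size s = d & m = mon s])
          (m \in monomials d).
Proof.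
apply: (iffP mapP) => [[s]|[s [std_s /eqP sd ->]]].
  by rewrite mem_standards // subnn => /andP[? /eqP ?] ->; exists s.
by exists s; rewrite // mem_standards // subnn std_s.
Qed.

Lemma monomials0 : 0%MM \in monomials 0.
Proof.
by apply/mem_monomials; exists [::]; split; rewrite ?mon_nil.
Qed.

(** Multiplying by a generator inserts one pair, and the result can be brought back to standard
    form. *)
Lemma monomials_gen d m (i : 'I_n) (j : 'I_c.+1) : m \in monomials d ->
  (U_(lshift c i) + U_(Ordinal (gen_idx_lt i j)) + m)%MM \in monomials d.+1.
Proof.
move=> /mem_monomials[s [std_s sd ->]]; rewrite -mon_cons.
have ij : (i <= i + j <= i + c)%N by have := ltn_ord j; lia.
have [|s' std_s' eq_s'] := @standard_insert n c 0 i (i + j) s _ ij std_s.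
  exact: ltn_ord.
apply/mem_monomials; exists s'; split=> //; last exact/esym/eq_mon.
by have := perm_size eq_s'; rewrite /= !size_unpair sd; lia.
Qed.

Lemma monomials_mdeg d m : m \in monomials d -> mdeg m = (2 * d)%N.
Proof.
case/mem_monomials => s [std_s <- ->]; rewrite mul2n -size_unpair mdegE.
under eq_bigr do rewrite mnmE -sum1_count big_mkcond.
rewrite exchange_big /= -sum1_size; apply: eq_big_seq => x xs.
rewrite (bigD1 (Ordinal (standard_lt std_s xs))) //= eqxx big1 // => i.
by rewrite -val_eqE /= eq_sym => /negbTE->.
Qed.

End Monomials.

Section Algebra.
Variables (K : fieldType) (n c : nat).

Lemma inA_monomials (p : {mpoly K[n + c]}) m :
  inA p -> m \in msupp p -> exists d, m \in monomials n c d.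
Proof.
case=> q ->; rewrite comp_mpolyE => /msupp_sum_le/flattenP[_ /mapP[k _ ->]].
move=> /msuppZ_le.
(* [P] contains 1 and is stable under multiplication by a generator, hence holds for every product
   of generators. *)
pose P (p : {mpoly K[n + c]}) := exists m d, m \in monomials n c d /\ p = 'X_[m].
suff [m' [d [m'd ->]]] : P (\prod_i (tnth (gens K n c) i) ^+ (k i)).
  by rewrite msuppX inE => /eqP->; exists d.
have P1 : P 1 by exists 0%MM, 0%N; rewrite monomials0 mpolyX0.
have Pgen i p' : P p' -> P (tnth (gens K n c) i * p').
  case=> m' [d [m'd ->]]; rewrite tnth_mktuple /gen -!mpolyXD.
  by eexists _, d.+1; split=> //; apply: monomials_gen.
rewrite -(mulr1 (\prod_i _)); elim/big_rec: _ => [|i x _]; first by rewrite mulr1.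
elim: (k i) => [|e IHe] Px; rewrite ?mul1r // exprS -!mulrA.
by apply/Pgen; rewrite mulrA; apply: IHe.
Qed.

Lemma inA_lin (a : K) (p q : {mpoly K[n + c]}) : inA p -> inA q -> inA (a *: p + q).
Proof. by move=> [p' ->] [q' ->]; exists (a *: p' + q'); rewrite linearP. Qed.

(** Each pair of the standard form contributes one generator as a factor. *)
Lemma inA_mon s lo : standard n c lo s -> inA ('X_[mon n c s] : {mpoly K[n + c]}).
Proof.
have inA1 : inA (1 : {mpoly K[n + c]}) by exists 1; rewrite rmorph1.
have inA_cons a b t : (a < n)%N -> (a <= b <= a + c)%N ->
    inA ('X_[mon n c t] : {mpoly K[n + c]}) ->
    inA ('X_[mon n c ((a, b) :: t)] : {mpoly K[n + c]}).
  move=> an ab [q eq_q]; have bc : (b - a < c.+1)%N by lia.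
  have -> : b = (Ordinal an + Ordinal bc)%N by rewrite /= subnKC //; lia.
  rewrite -[a in (a, _)]/(val (Ordinal an)) mon_cons 2!mpolyXD eq_q.
  exists ('X_(enum_rank (Ordinal an, Ordinal bc)) * q).
  by rewrite rmorphM /= comp_mpolyXU -tnth_nth tnth_mktuple enum_rankK.
have big_mon t lo1 hi : big_pairs n c lo1 hi t -> (n <= hi)%N ->
    inA ('X_[mon n c t] : {mpoly K[n + c]}).
  elim: t lo1 hi => [|[a b] t IHt] lo1 hi; first by rewrite mon_nil mpolyX0.
  move=> /= /and5P[_ an hb ba /IHt big_t] nh; apply: inA_cons; try lia.
  by apply: big_t; lia.
elim: s lo => [|[a b] s IHs] lo; first by rewrite mon_nil mpolyX0.
rewrite standard_cons; case: ifP => bn; last by move=> /big_mon; apply.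
by move=> /and4P[_ ab ba /IHs mon_s]; apply: inA_cons => //; lia.
Qed.

Lemma inAd_monomials d (p : {mpoly K[n + c]}) :
  inAd d p <-> {subset msupp p <= monomials n c d}.
Proof.
split=> [[Ap /dhomogP hp] m mp|pL].
  have [e me] := inA_monomials Ap mp.
  (* The degree of [m] is both [2 * d] and [2 * e]. *)
  suff -> : d = e by [].
  by have := hp m mp; rewrite /= (monomials_mdeg me); lia.
split; last by apply/dhomogP => m /pL/monomials_mdeg.
rewrite [p]mpolyE big_seq.
elim/big_rec: _ => [|m q /pL/mem_monomials[s [std_s _ ->]] Aq].
  by exists 0; rewrite raddf0.
by apply: inA_lin Aq; apply: inA_mon std_s.
Qed.

End Algebra.

(* h n d = dim_K [A_n]_d (for n >= 1); the equivariant Hilbert series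
   sum_{n>=1} sum_{d>=0} h n d t^d s^n is rational. *)
Theorem theorem5p3 (K : fieldType) (c : nat) :
  exists h : nat -> nat -> nat,
    (forall n d, (0 < n)%N -> has_dim (@inAd K n c d) (h n d)) /\
    rational_series2 (fun n d => if n is 0 then 0 else (h n d)%:R).
Proof.
exists (fun n d => nstd c d n); split; last exact: rational_series.
move=> n d _; rewrite -(size_standards c d (leqnn n)) -(size_map (mon n c)).
exact: has_dim_monomials (uniq_monomials n c d) (@inAd_monomials K n c d).
Qed.
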